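(* Let $\eta$ be a unit pure imaginary quaternion and let $A = A_s+\epsilon A_i$, with $A_s,A_i\in\mathbb{H}^{n\times n}$, be a dual quaternion matrix which is $\eta$-Hermitian, i.e. $A = A^{\eta H}$. Then there exist a unitary dual quaternion matrix $V=V_s+\epsilon V_i$ with $V_s,V_i\in\mathbb{H}^{n\times n}$ and a dual real diagonal matrix $\Sigma = \Sigma_s+\epsilon\Sigma_i$ with $\Sigma_s,\Sigma_i\in\mathbb{R}^{n\times n}$ diagonal such that $$A = V\Sigma V^{\eta H}.$$
   Context: $\mathbb{H}$ denotes the real quaternions. A dual quaternion matrix is a formal expression $A=A_s+\epsilon A_i$ with $A_s,A_i\in\mathbb{H}^{m\times n}$, where $\epsilon$ commutes with everything and $\epsilon^2=0$; so addition is componentwise and $(A_s+\epsilon A_i)(B_s+\epsilon B_i)=A_sB_s+\epsilon(A_sB_i+A_iB_s)$. Dual real matrices are defined likewise with real parts. A unit pure imaginary quaternion $\eta$ satisfies $\eta^H=\bar\eta=-\eta$ and $\eta^2=-1$. For a quaternion matrix $M$, $M^H=\overline{M}^{\top}$ is the conjugate transpose and $M^{\eta H}=\eta^H M^H\eta$. For a dual quaternion matrix, $A^{H}=A_s^{H}+\epsilon A_i^{H}$ and $A^{\eta H}=A_s^{\eta H}+\epsilon A_i^{\eta H}$; thus $A$ is $\eta$-Hermitian iff both $A_s=A_s^{\eta H}$ and $A_i=A_i^{\eta H}$. An $n\times n$ dual quaternion matrix $V$ is unitary if $VV^H=I_n$, i.e. $V_sV_s^H=I_n$ and $V_sV_i^H+V_iV_s^H=O$.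 *)

(* Defs.v *)
From HB Require Import structures.
From mathcomp Require Import all_boot all_order all_algebra.
From mathcomp Require Import reals.
From mathcomp Require Import ring.

Set Implicit Arguments.
Unset Strict Implicit.
Unset Printing Implicit Defensive.

Import GRing.Theory.
Local Open Scope ring_scope.

(* [Quat a b c d] is a + b i + c j + d k. *)
Record quat (R : Type) := Quat { qre : R; qi : R; qj : R; qk : R }.

Section QuatChoice.

Variable R : choiceType.

Definition prod_of_quat (x : quat R) : R * R * R * R :=
  (qre x, qi x, qj x, qk x).

Definition quat_of_prod (t : R * R * R * R) : quat R :=
  let: (a, b, c, d) := t in Quat a b c d.

Lemma prod_of_quatK : cancel prod_of_quat quat_of_prod.
Proof. by case. Qed.

HB.instance Definition _ := Choice.copy (quat R) (can_type prod_of_quatK).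

End QuatChoice.

Section QuatRing.

Variable R : comNzRingType.
Implicit Types x y z : quat R.

Definition addq x y :=
  Quat (qre x + qre y) (qi x + qi y) (qj x + qj y) (qk x + qk y).

Definition oppq x := Quat (- qre x) (- qi x) (- qj x) (- qk x).

(* i^2 = j^2 = k^2 = i j k = -1 *)
Definition mulq x y :=
  let: Quat a b c d := x in
  let: Quat a' b' c' d' := y in
  Quat (a * a' - b * b' - c * c' - d * d')
       (a * b' + b * a' + c * d' - d * c')
       (a * c' - b * d' + c * a' + d * b')
       (a * d' + b * c' - c * b' + d * a').

Definition realq (a : R) := Quat a 0 0 0.

Lemma addqA : associative addq.
Proof. by case=> [????] [????] [????]; rewrite /addq /= !addrA. Qed.

Lemma addqC : commutative addq.
Proof.
case=> [a b c d] [a' b' c' d']; rewrite /addq /=.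
by rewrite (addrC a) (addrC b) (addrC c) (addrC d).
Qed.

Lemma add0q : left_id (realq 0) addq.
Proof. by case=> [????]; rewrite /addq /= !add0r. Qed.

Lemma addNq : left_inverse (realq 0) oppq addq.
Proof. by case=> [????]; rewrite /addq /oppq /realq /= !addNr. Qed.

HB.instance Definition _ := GRing.isZmodule.Build (quat R)
  addqA addqC add0q addNq.

Lemma mulqA : associative mulq.
Proof. by case=> [????] [????] [????]; rewrite /mulq; congr Quat; ring. Qed.

Lemma mul1q : left_id (realq 1) mulq.
Proof. by case=> [????]; rewrite /mulq /realq; congr Quat; ring. Qed.

Lemma mulq1 : right_id (realq 1) mulq.
Proof. by case=> [????]; rewrite /mulq /realq; congr Quat; ring. Qed.

Lemma mulqDl : left_distributive mulq addq.
Proof.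
by case=> [????] [????] [????]; rewrite /mulq /addq /=; congr Quat; ring.
Qed.

Lemma mulqDr : right_distributive mulq addq.
Proof.
by case=> [????] [????] [????]; rewrite /mulq /addq /=; congr Quat; ring.
Qed.

Lemma oneq_neq0 : realq 1 != 0 :> quat R.
Proof. by apply/eqP => -[] /eqP; rewrite oner_eq0. Qed.

HB.instance Definition _ := GRing.Zmodule_isNzRing.Build (quat R)
  mulqA mul1q mulq1 mulqDl mulqDr oneq_neq0.

Definition conjq x := Quat (qre x) (- qi x) (- qj x) (- qk x).

Definition normsq x := qre x ^+ 2 + qi x ^+ 2 + qj x ^+ 2 + qk x ^+ 2.

Definition unit_pure_imaginary x := qre x = 0 /\ normsq x = 1.

Lemma mulq_conj x : x * conjq x = realq (normsq x).
Proof.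
by case: x => [????]; rewrite /GRing.mul /= /normsq /=; congr Quat; ring.
Qed.

Lemma unit_pure_imaginary_conj x : unit_pure_imaginary x -> conjq x = - x.
Proof.
case: x => [a b c d] [/= -> _].
by rewrite /conjq /GRing.opp /= /oppq /= oppr0.
Qed.

Lemma unit_pure_imaginary_sqr x : unit_pure_imaginary x -> x ^+ 2 = -1.
Proof.
move=> hx; apply: oppr_inj; rewrite opprK expr2 -mulrN.
by rewrite -unit_pure_imaginary_conj // mulq_conj (proj2 hx).
Qed.

(* M^H *)
Definition hermq m n (M : 'M[quat R]_(m, n)) : 'M[quat R]_(n, m) :=
  (map_mx conjq M)^T.

(* M^{eta H} = eta^H M^H eta; quaternion scalars act on either side as the
   matrices [a%:M]. *)
Definition etahermq (eta : quat R) m n (M : 'M[quat R]_(m, n)) :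
    'M[quat R]_(n, m) :=
  (conjq eta)%:M *m hermq M *m eta%:M.

End QuatRing.

(* [DualMx S I] is the dual matrix S + epsilon I, with epsilon^2 = 0. *)
Record dualmx (T : Type) (m n : nat) :=
  DualMx { stdpart : 'M[T]_(m, n); infpart : 'M[T]_(m, n) }.

Definition dualmx_add (T : nzRingType) m n (A B : dualmx T m n) :
    dualmx T m n :=
  DualMx (stdpart A + stdpart B) (infpart A + infpart B).

Definition dualmx_mul (T : nzRingType) m n p
    (A : dualmx T m n) (B : dualmx T n p) : dualmx T m p :=
  DualMx (stdpart A *m stdpart B)
         (stdpart A *m infpart B + infpart A *m stdpart B).

Definition dualmx1 (T : nzRingType) n : dualmx T n n := DualMx 1%:M 0.

Definition dualmx_diag (T : nzRingType) n (A : dualmx T n n) : Prop :=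
  is_diag_mx (stdpart A) /\ is_diag_mx (infpart A).

Section DualQuaternionMatrix.

Variable R : comNzRingType.

Definition dualmx_realq m n (A : dualmx R m n) : dualmx (quat R) m n :=
  DualMx (map_mx (@realq R) (stdpart A)) (map_mx (@realq R) (infpart A)).

Definition dualmx_herm m n (A : dualmx (quat R) m n) : dualmx (quat R) n m :=
  DualMx (hermq (stdpart A)) (hermq (infpart A)).

Definition dualmx_etaherm (eta : quat R) m n (A : dualmx (quat R) m n) :
    dualmx (quat R) n m :=
  DualMx (etahermq eta (stdpart A)) (etahermq eta (infpart A)).

Definition eta_hermitian (eta : quat R) n (A : dualmx (quat R) n n) : Prop :=
  A = dualmx_etaherm eta A.

Definition dualmx_unitary n (V : dualmx (quat R) n n) : Prop :=
  dualmx_mul V (dualmx_herm V) = dualmx1 (quat R) n.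

End DualQuaternionMatrix.

(* Main.v *)
(* If [A] is eta-Hermitian then [K = A eta] is skew-Hermitian, and
   [A = V S V^{eta H}] amounts to [K = V (S eta) V^H]; conjugating by a unit
   quaternion one may replace eta by i. So the claim is a spectral theorem for
   skew-Hermitian matrices over the dual quaternions, seen as the quaternions
   over the commutative ring of dual numbers. It follows by induction from the
   existence of a unit row [u] with [u K = (s i) u], which is completed to a
   unitary matrix. To find [u + eps v], view quaternionic rows as complex rows
   of twice the length: take an eigenvalue [l] of [K_s], and let [u] be an
   eigenvector of the compression of [K_i] to the kernel of [K_s - l]; the
   first-order equation for [v] is solvable because this kernel is a complement
   of the image of [K_s - l]. *)

Require Import Defs.
From HB Require Import structures.
From mathcomp Require Import all_boot all_order all_algebra.
From mathcomp Require Import reals ring lra.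
From mathcomp Require Import complex.

Set Implicit Arguments.
Unset Strict Implicit.
Unset Printing Implicit Defensive.

Import Order.TTheory GRing.Theory Num.Theory.
Local Open Scope ring_scope.

Lemma scalar_mxN (U : zmodType) n (x : U) : (- x)%:M = - x%:M :> 'M_n.
Proof. exact: raddfN. Qed.

(** * Conjugation and central scalars in quaternions over a commutative ring *)

Section QuatConj.

Variable T : comNzRingType.
Implicit Types x y : quat T.

Lemma quatD x y : x + y =
  Quat (qre x + qre y) (qi x + qi y) (qj x + qj y) (qk x + qk y).
Proof. by []. Qed.

Lemma quatN x : - x = Quat (- qre x) (- qi x) (- qj x) (- qk x).
Proof. by []. Qed.

Lemma quatM (a b c d a' b' c' d' : T) : Quat a b c d * Quat a' b' c' d' =
  Quat (a * a' - b * b' - c * c' - d * d')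
       (a * b' + b * a' + c * d' - d * c')
       (a * c' - b * d' + c * a' + d * b')
       (a * d' + b * c' - c * b' + d * a').
Proof. by []. Qed.

Lemma quat0 : 0 = Quat 0 0 0 0 :> quat T. Proof. by []. Qed.

Lemma quat1 : 1 = Quat 1 0 0 0 :> quat T. Proof. by []. Qed.

Lemma conjqD x y : conjq (x + y) = conjq x + conjq y.
Proof. by rewrite !quatD /conjq /= !opprD. Qed.

Lemma conjq0 : conjq 0 = 0 :> quat T.
Proof. by rewrite quat0 /conjq /= oppr0. Qed.

Lemma conjqN x : conjq (- x) = - conjq x.
Proof. by rewrite !quatN /conjq. Qed.

Lemma conjq1 : conjq 1 = 1 :> quat T.
Proof. by rewrite quat1 /conjq /= oppr0. Qed.

Lemma conjqK x : conjq (conjq x) = x.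
Proof. by case: x => ????; rewrite /conjq /= !opprK. Qed.

Lemma conjqM x y : conjq (x * y) = conjq y * conjq x.
Proof.
case: x => ????; case: y => ????; rewrite /conjq !quatM /=.
by congr Quat; ring.
Qed.

Lemma conjq_sum I (r : seq I) (F : I -> quat T) :
  conjq (\sum_(i <- r) F i) = \sum_(i <- r) conjq (F i).
Proof. exact: (big_morph _ conjqD conjq0). Qed.

Lemma conjq_mulC x : conjq x * x = x * conjq x.
Proof.
case: x => ????; rewrite /conjq !quatM /=.
by congr Quat; ring.
Qed.

Lemma realq_comm t x : realq t * x = x * realq t.
Proof. by case: x => ????; rewrite /realq !quatM; congr Quat; ring. Qed.

Lemma conjq_realq (t : T) : conjq (realq t) = realq t.
Proof. by rewrite /conjq /realq /= oppr0. Qed.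

Lemma realqM (s t : T) : realq (s * t) = realq s * realq t.
Proof. by rewrite /realq quatM; congr Quat; ring. Qed.

Lemma realqD (s t : T) : realq (s + t) = realq s + realq t.
Proof. by rewrite /realq quatD /= !addr0. Qed.

Lemma realq0 : realq 0 = 0 :> quat T. Proof. by []. Qed.

Lemma realq_sum I (r : seq I) (F : I -> T) :
  realq (\sum_(i <- r) F i) = \sum_(i <- r) realq (F i).
Proof. exact: (big_morph _ realqD realq0). Qed.

End QuatConj.

(** * Conjugate transposes, completion of unit rows, and the spectral induction *)

Section QuatHerm.

Variable T : comNzRingType.

Lemma hermqE m n (A : 'M[quat T]_(m, n)) i j : hermq A i j = conjq (A j i).
Proof. by rewrite !mxE. Qed.

Lemma hermqK m n (A : 'M[quat T]_(m, n)) : hermq (hermq A) = A.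
Proof. by apply/matrixP => i j; rewrite !hermqE conjqK. Qed.

Lemma hermqD m n (A B : 'M[quat T]_(m, n)) :
  hermq (A + B) = hermq A + hermq B.
Proof. by apply/matrixP => i j; rewrite !mxE conjqD. Qed.

Lemma hermqN m n (A : 'M[quat T]_(m, n)) : hermq (- A) = - hermq A.
Proof. by apply/matrixP => i j; rewrite !mxE conjqN. Qed.

Lemma hermq0 m n : hermq (0 : 'M[quat T]_(m, n)) = 0.
Proof. by apply/matrixP => i j; rewrite !mxE conjq0. Qed.

Lemma hermq_scalar n (x : quat T) : hermq (x%:M : 'M_n) = (conjq x)%:M.
Proof.
by apply/matrixP => i j; rewrite !mxE eq_sym; case: eqP; rewrite ?conjq0.
Qed.

Lemma hermq1 n : hermq (1%:M : 'M[quat T]_n) = 1%:M.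
Proof. by rewrite hermq_scalar conjq1. Qed.

Lemma hermqM m n p (A : 'M[quat T]_(m, n)) (B : 'M_(n, p)) :
  hermq (A *m B) = hermq B *m hermq A.
Proof.
apply/matrixP => i j; rewrite hermqE !mxE conjq_sum.
by apply: eq_bigr => k _; rewrite !hermqE conjqM.
Qed.

Lemma hermq_block m1 m2 n1 n2 (A : 'M[quat T]_(m1, n1)) (B : 'M_(m1, n2))
    (C : 'M_(m2, n1)) (D : 'M_(m2, n2)) :
  hermq (block_mx A B C D) =
  block_mx (hermq A) (hermq C) (hermq B) (hermq D).
Proof. by rewrite /hermq map_block_mx tr_block_mx. Qed.

Lemma hermq_row m n1 n2 (A : 'M[quat T]_(m, n1)) (B : 'M_(m, n2)) :
  hermq (row_mx A B) = col_mx (hermq A) (hermq B).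
Proof. by rewrite /hermq map_row_mx tr_row_mx. Qed.

Lemma mulmx_scalarE m n (A : 'M[quat T]_(m, n)) x i j :
  (A *m x%:M) i j = A i j * x.
Proof.
rewrite !mxE (bigD1 j) //= big1; first by rewrite !mxE eqxx addr0.
by move=> k kj; rewrite !mxE (negPf kj) mulr0.
Qed.

Lemma mulmx_realq m n (A : 'M[quat T]_(m, n)) (t : T) :
  A *m (realq t)%:M = (realq t)%:M *m A.
Proof.
by apply/matrixP => i j; rewrite mulmx_scalarE mul_scalar_mx mxE realq_comm.
Qed.

Lemma hermq_mulC (a : 'M[quat T]_1) : hermq a *m a = a *m hermq a.
Proof.
by rewrite (mx11_scalar a) hermq_scalar -!scalar_mxM conjq_mulC.
Qed.

Lemma hermq_row_normsq n (u : 'rV[quat T]_n) :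
  u *m hermq u = (realq (\sum_i normsq (u 0 i)))%:M.
Proof.
rewrite [LHS]mx11_scalar; congr (_%:M).
rewrite !mxE realq_sum; apply: eq_bigr => i _.
by rewrite hermqE mulq_conj.
Qed.

(* Over a noncommutative ring [Q^H Q = 1] does not formally yield
   [Q Q^H = 1]; only its first row is needed. *)
Lemma unitary_completion n (a s c : 'M[quat T]_1) (b : 'rV_n) (t : T)
    (Q := block_mx a b (- (hermq b *m s)) (1%:M - hermq b *m c *m b)) :
  a *m hermq a + b *m hermq b = 1%:M ->
  b *m hermq b = (realq t)%:M ->
  s *m hermq a + (realq t)%:M *m c = 1%:M ->
  hermq s *m s = 1%:M ->
  c + hermq c = 1%:M + (realq t)%:M *m (hermq c *m c) ->
  row_mx a b *m hermq Q = row_mx 1%:M 0 /\ hermq Q *m Q = 1%:M.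
Proof.
move=> ab1 bt sc1 s1 cc.
have Qherm : hermq Q = block_mx (hermq a) (- (hermq s *m b))
    (hermq b) (1%:M - hermq b *m hermq c *m b).
  by rewrite hermq_block hermqN hermqD hermqN hermq1 !hermqM hermqK mulmxA.
have as1 : a *m hermq s + (realq t)%:M *m hermq c = 1%:M.
  rewrite -mulmx_realq -(hermq1 1) -sc1.
  by rewrite hermqD !hermqM hermqK hermq_scalar conjq_realq.
(* Left multiplication of [s a^H + t c = 1] by [s^H] isolates [a^H]; substituting it cancels the
   off-diagonal block of [Q^H Q]. *)
have sa : hermq a = hermq s - (realq t)%:M *m (hermq s *m c).
  rewrite -[X in X - _]mulmx1 -sc1 mulmxDr !mulmxA s1 mul1mx.
  by rewrite mulmx_realq -!mulmxA addrK.
have e12 : hermq a *m b + - (hermq s *m b) *m (1%:M - hermq b *m c *m b) = 0.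
  rewrite mulNmx mulmxBr mulmx1 !mulmxA -[_ *m b *m hermq b]mulmxA bt.
  rewrite sa mulmx_realq mulmxBl !mulmxA opprB addrA.
  by rewrite addrNK subrr.
rewrite Qherm; split.
  rewrite mul_row_block; congr row_mx; first by rewrite ab1.
  rewrite mulmxN mulmxBr mulmx1 !mulmxA bt addrCA -opprD -mulmxDl.
  by rewrite as1 mul1mx subrr.
rewrite mulmx_block [RHS](scalar_mx_block 1 n 1); congr block_mx => //.
- rewrite mulNmx mulmxN opprK !mulmxA -[_ *m b *m hermq b]mulmxA bt.
  by rewrite mulmx_realq -mulmxA s1 mulmx1 hermq_mulC -bt.
- rewrite -(hermq0 1 n) -e12 !(hermqD, hermqN, hermqM, hermqK, hermq1).
  by rewrite mulmxA.
rewrite mulmxBl mul1mx mulmxBr mulmx1 !mulmxA.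
(* The product of the two corrections contains [b b^H = t], so [cc] makes it linear in [c] and
   [c^H], and the lower right block collapses to the identity. *)
have -> : hermq b *m hermq c *m b *m hermq b *m c *m b =
    hermq b *m (c + hermq c - 1%:M) *m b.
  rewrite cc addrAC subrr add0r -[_ *m b *m hermq b]mulmxA bt.
  by rewrite mulmx_realq [in RHS]mulmxA mulmx_realq !mulmxA.
rewrite mulmxBr mulmxBl mulmxDr mulmxDl mulmx1.
set x := _ *m c *m b; set y := _ *m hermq c *m b; set z := _ *m b.
have -> : y - (x + y - z) = z - x.
  by rewrite opprB addrCA; congr (z + _); rewrite opprD addrCA subrr addr0.
by rewrite opprB -addrA addKr addrCA subrr addr0.
Qed.

(** Instantiates the completion with [s = a] when [t = 0] and [s = 1] when [t] is invertible. In the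
    first case [b] can be nonzero: over the dual numbers it may be purely infinitesimal. *)
Lemma unitary_row n (a : 'M[quat T]_1) (b : 'rV_n) (t h : T) :
  h + h = 1 -> t = 0 \/ (exists v, v * t = 1) ->
  a *m hermq a + b *m hermq b = 1%:M -> b *m hermq b = (realq t)%:M ->
  exists Q : 'M_(1 + n),
    row_mx a b *m hermq Q = row_mx 1%:M 0 /\ hermq Q *m Q = 1%:M.
Proof.
move=> hh1 [->|[v vt]] ab1 bt.
  have r0 : (realq 0)%:M = 0 :> 'M[quat T]_1 by rewrite realq0 raddf0.
  (* For [t = 0] the last condition reads [c + c^H = 1], whence one half. *)
  pose c : 'M[quat T]_1 := (realq h)%:M.
  exists (block_mx a b (- (hermq b *m a)) (1%:M - hermq b *m c *m b)).
  have aa1 : a *m hermq a = 1%:M by rewrite -ab1 bt r0 addr0.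
  apply: (unitary_completion ab1 bt).
  - by rewrite r0 mul0mx addr0.
  - by rewrite hermq_mulC.
  rewrite r0 mul0mx addr0 hermq_scalar conjq_realq.
  by rewrite -raddfD -realqD hh1.
(* With [s = 1], the relation [a^H + t c = 1] forces this [c]. *)
pose c := (realq v)%:M *m (1%:M - hermq a).
exists (block_mx a b (- (hermq b *m 1%:M)) (1%:M - hermq b *m c *m b)).
have tv : (realq t)%:M *m (realq v)%:M = 1%:M :> 'M[quat T]_1.
  by rewrite -scalar_mxM -realqM mulrC vt.
have hc : hermq c = (realq v)%:M *m (1%:M - a).
  rewrite hermqM hermqD hermqN hermqK hermq1 hermq_scalar conjq_realq.
  by rewrite mulmx_realq.
apply: (unitary_completion ab1 bt).
- by rewrite mul1mx mulmxA tv mul1mx addrC subrK.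
- by rewrite hermq1 mul1mx.
have aa : a *m hermq a = 1%:M - (realq t)%:M by rewrite -bt -ab1 addrK.
rewrite hc /c; set V := (realq v)%:M in tv *.
have -> : (realq t)%:M *m (V *m (1%:M - a) *m (V *m (1%:M - hermq a))) =
    V *m ((1%:M - a) *m (1%:M - hermq a)).
  by rewrite -[V *m _ *m _]mulmxA mulmxA tv mul1mx !mulmxA mulmx_realq.
have -> : (1%:M - a) *m (1%:M - hermq a) =
    (1%:M - hermq a) + (1%:M - a) - (realq t)%:M.
  rewrite mulmxBl mul1mx mulmxBr mulmx1 aa opprB.
  by rewrite -[RHS]addrA; congr (_ + _); rewrite addrAC.
by rewrite -mulmxDr [in RHS]mulmxBr mulmx_realq tv [RHS]addrC subrK.
Qed.

(** Once [u] is scaled by [r] to a unit row [v], one has [l = v K v^H], so [l] inherits skewness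
    from [K]. Twice its real part is then zero, and halving leaves a multiple of i. *)
Lemma normalized_eigenrow n (K : 'M[quat T]_n) (u : 'rV_n)
    (l : quat T) (t r h : T) :
  h + h = 1 -> hermq K = - K -> u *m hermq u = (realq t)%:M ->
  r * r * t = 1 -> qj l = 0 -> qk l = 0 -> u *m K = l%:M *m u ->
  exists (v : 'rV_n) (s : T), v *m hermq v = 1%:M /\
    v *m K = (Quat 0 s 0 0)%:M *m v.
Proof.
move=> hh1 KN ut rt lj lk uK.
have [v vv vK] : exists2 v : 'rV_n, v *m hermq v = 1%:M & v *m K = l%:M *m v.
  exists ((realq r)%:M *m u); last by rewrite -mulmxA uK !mulmxA mulmx_realq.
  rewrite hermqM hermq_scalar conjq_realq !mulmxA -[_ *m u *m _]mulmxA ut.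
  by rewrite -!scalar_mxM -!realqM mulrAC rt.
have lE : l%:M = v *m K *m hermq v by rewrite vK -mulmxA vv mulmx1.
have lN : conjq l = - l.
  have : hermq (v *m K *m hermq v) = - (v *m K *m hermq v).
    by rewrite !hermqM hermqK KN mulNmx mulmxN mulmxA.
  rewrite -lE hermq_scalar => /matrixP/(_ 0 0).
  by rewrite !mxE eqxx !mulr1n.
exists v, (qi l); split=> //; rewrite vK; congr (_%:M *m _).
case: l lj lk lN {uK vK lE} => a b c d /= -> -> [aN].
have a2 : a + a = 0 by rewrite [X in X + _]aN addNr.
by have -> : a = 0 by rewrite -[a]mul1r -hh1 mulrDl -mulrDr a2 mulr0.
Qed.

(** Deflation: split off one unit eigenrow, complete it to a unitary matrix, and recurse on the
    remaining block. *)
Lemma skew_hermitian_spectral :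
  (forall n (K : 'M[quat T]_n.+1), hermq K = - K ->
    exists (u : 'rV_n.+1) (s : T), u *m hermq u = 1%:M /\
      u *m K = (Quat 0 s 0 0)%:M *m u) ->
  (forall n (a : 'M[quat T]_1) (b : 'rV_n),
    a *m hermq a + b *m hermq b = 1%:M ->
    exists Q : 'M_(1 + n),
      row_mx a b *m hermq Q = row_mx 1%:M 0 /\ hermq Q *m Q = 1%:M) ->
  forall n (K : 'M[quat T]_n), hermq K = - K ->
  exists (V : 'M_n) (d : 'rV[T]_n), V *m hermq V = 1%:M /\
    K = V *m (map_mx (@realq T) (diag_mx d) *m (Quat 0 1 0 0)%:M) *m hermq V.
Proof.
move=> eigen completion; elim=> [|n IHn] K KN.
  by exists 1%:M, 0; split; rewrite [LHS]flatmx0 [RHS]flatmx0.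
have [u [s [uu uK]]] := eigen n K KN.
rewrite -[n.+1]/(1 + n)%N in K KN u uu uK *.
move: uu; rewrite -{1 2}[u]hsubmxK hermq_row mul_row_col => /completion.
rewrite hsubmxK => -[Q [uQ QQ]].
pose D := Q *m K *m hermq Q.
(* As [u Q^H] is the first basis row, the first row of [D] is [(s i, 0)]; skewness of [D] then
   clears the column below it. *)
have DN : hermq D = - D.
  by rewrite !hermqM hermqK KN mulNmx mulmxN mulmxA.
have DE : row_mx 1%:M 0 *m D = row_mx (Quat 0 s 0 0)%:M 0.
  have -> : row_mx 1%:M 0 *m D = u *m K *m hermq Q.
    by rewrite -uQ /D !mulmxA -[u *m _ *m Q]mulmxA QQ mulmx1.
  by rewrite uK -mulmxA uQ mul_mx_row mulmx1 mulmx0.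
have KD : K = hermq Q *m D *m Q.
  by rewrite /D !mulmxA QQ mul1mx -mulmxA QQ mulmx1.
move: DE DN KD; rewrite -[D]submxK.
move: (ulsubmx D) (ursubmx D) (dlsubmx D) (drsubmx D) => A B C E.
rewrite mul_row_block !mul1mx !mul0mx !addr0 => /eq_row_mx[-> ->].
rewrite hermq_block opp_block_mx hermq0 => /eq_block_mx[_ _ C0 EN] KD.
have {C0} C0 : C = 0 by rewrite -[C]opprK -C0 oppr0.
have [V [d [VV EV]]] := IHn E EN.
(* With [hermq Q] on the left, unitarity reduces to [hermq Q *m Q = 1%:M], the side provided by the
   completion. *)
exists (hermq Q *m block_mx 1%:M 0 0 V), (row_mx s%:M d).
rewrite hermqM hermqK hermq_block hermq1 !hermq0 !mulmxA.
split.
  rewrite -[hermq Q *m _ *m block_mx _ _ _ _]mulmxA mulmx_block.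
  rewrite !mulmx1 !mulmx0 !mul0mx !addr0 add0r VV.
  by rewrite -[block_mx _ _ _ _]scalar_mx_block mulmx1.
rewrite KD C0 EV diag_mx_row map_block_mx; congr (_ *m _).
rewrite -!mulmxA; congr (_ *m _).
have r0 k l : map_mx (@realq T) (0 : 'M_(k, l)) = 0.
  by apply/matrixP => i j; rewrite !mxE realq0.
rewrite (scalar_mx_block 1 n) !mulmx_block !r0.
rewrite !mulmx0 !mul0mx !mulmx1 !mul1mx !addr0 !add0r !mulmx0 !mulmxA.
congr block_mx; apply/matrixP => i j; rewrite !ord1 mulmx_scalarE !mxE.
by rewrite eqxx !mulr1n /realq quatM; congr Quat; ring.
Qed.

(* Multiplying by [eta] on the right turns an [eta]-Hermitian matrix into a
   skew-Hermitian one, and [V D V^{eta H}] into [V (D eta) V^H]. *)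
Lemma eta_hermitian_of_skew n (A : 'M[quat T]_n) (eta p : quat T) :
  conjq eta = - eta -> eta * eta = -1 ->
  conjq p * p = 1 -> p * eta = Quat 0 1 0 0 * p ->
  (forall K : 'M[quat T]_n, hermq K = - K ->
    exists (V : 'M_n) (d : 'rV[T]_n), V *m hermq V = 1%:M /\
      K = V *m (map_mx (@realq T) (diag_mx d) *m (Quat 0 1 0 0)%:M)
            *m hermq V) ->
  A = etahermq eta A ->
  exists (V : 'M_n) (d : 'rV[T]_n), V *m hermq V = 1%:M /\
    A = V *m map_mx (@realq T) (diag_mx d) *m etahermq eta V.
Proof.
move=> etaN eta2 pp peta spectral AH.
have pp' : p * conjq p = 1 by rewrite -conjq_mulC.
have piV : Quat 0 1 0 0 = p * eta * conjq p.
  by rewrite peta -mulrA pp' mulr1.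
have KN : hermq (A *m eta%:M) = - (A *m eta%:M).
  rewrite {2}AH /etahermq -mulmxA -scalar_mxM eta2 hermqM hermq_scalar.
  by rewrite scalar_mxN mulmxN mulmx1 opprK.
have [V [d [VV AE]]] := spectral _ KN.
(* Since [p eta p^H] is i and [p] commutes with the real diagonal matrix [D],
   [V D i V^H = (V p) D eta (V p)^H]. *)
exists (V *m p%:M), d; split.
  rewrite hermqM hermq_scalar mulmxA -[_ *m p%:M *m _]mulmxA -scalar_mxM.
  by rewrite pp' mulmx1.
have Dp : p%:M *m map_mx (@realq T) (diag_mx d) =
    map_mx (@realq T) (diag_mx d) *m p%:M.
  apply/matrixP => i j.
  by rewrite mulmx_scalarE mul_scalar_mx mxE mxE realq_comm.
have <- : A *m eta%:M *m (- eta)%:M = A.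
  by rewrite -mulmxA -scalar_mxM mulrN eta2 opprK mulmx1.
rewrite AE /etahermq hermqM hermq_scalar etaN piV !scalar_mxM !scalar_mxN.
rewrite !mulmxN !mulNmx !mulmxN !mulmxA.
by rewrite -[_ *m p%:M *m map_mx _ _]mulmxA Dp !mulmxA.
Qed.

End QuatHerm.

(** * The commutative ring of dual numbers *)

Record dual (T : Type) := Dual { dre : T; dinf : T }.

Section DualChoice.

Variable T : choiceType.

Definition prod_of_dual (x : dual T) : T * T := (dre x, dinf x).

Definition dual_of_prod (t : T * T) : dual T := let: (a, b) := t in Dual a b.

Lemma prod_of_dualK : cancel prod_of_dual dual_of_prod.
Proof. by case. Qed.

HB.instance Definition _ := Choice.copy (dual T) (can_type prod_of_dualK).

End DualChoice.

Section DualRing.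

Variable T : comNzRingType.
Implicit Types x y : dual T.

Definition addd x y := Dual (dre x + dre y) (dinf x + dinf y).

Definition oppd x := Dual (- dre x) (- dinf x).

Definition muld x y :=
  Dual (dre x * dre y) (dre x * dinf y + dinf x * dre y).

Lemma adddA : associative addd.
Proof. by case=> [??] [??] [??]; rewrite /addd /= !addrA. Qed.

Lemma adddC : commutative addd.
Proof. by move=> x y; congr Dual; rewrite addrC. Qed.

Lemma add0d : left_id (Dual 0 0) addd.
Proof. by case=> ??; rewrite /addd /= !add0r. Qed.

Lemma addNd : left_inverse (Dual 0 0) oppd addd.
Proof. by case=> ??; rewrite /addd /= !addNr. Qed.

HB.instance Definition _ := GRing.isZmodule.Build (dual T)
  adddA adddC add0d addNd.

Lemma muldA : associative muld.
Proof. by case=> [??] [??] [??]; rewrite /muld /=; congr Dual; ring. Qed.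

Lemma muldC : commutative muld.
Proof. by case=> [??] [??]; rewrite /muld /=; congr Dual; ring. Qed.

Lemma mul1d : left_id (Dual 1 0) muld.
Proof. by case=> ??; rewrite /muld /=; congr Dual; ring. Qed.

Lemma muldDl : left_distributive muld addd.
Proof. by case=> [??] [??] [??]; rewrite /muld /addd /=; congr Dual; ring. Qed.

Lemma oned_neq0 : Dual 1 0 != 0 :> dual T.
Proof. by apply/eqP => -[] /eqP; rewrite oner_eq0. Qed.

HB.instance Definition _ := GRing.Zmodule_isComNzRing.Build (dual T)
  muldA muldC mul1d muldDl oned_neq0.

Lemma dual0 : 0 = Dual 0 0 :> dual T. Proof. by []. Qed.

Lemma dual1 : 1 = Dual 1 0 :> dual T. Proof. by []. Qed.

Lemma dualD x y : x + y = Dual (dre x + dre y) (dinf x + dinf y).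
Proof. by []. Qed.

Lemma dualM x y :
  x * y = Dual (dre x * dre y) (dre x * dinf y + dinf x * dre y).
Proof. by []. Qed.

Lemma dualN x : - x = Dual (- dre x) (- dinf x).
Proof. by []. Qed.

Lemma dre_sum I (r : seq I) (F : I -> dual T) :
  dre (\sum_(i <- r) F i) = \sum_(i <- r) dre (F i).
Proof. by elim/big_rec2: _ => //= i y1 y2 _ <-. Qed.

End DualRing.

(* Dual quaternion matrices are treated as matrices over [quat (dual T)], so
   that [hermq] and the other notions of quaternion matrices apply to them. *)
Section DualQuaternion.

Variable T : comNzRingType.
Implicit Types x y : quat T.

Definition dualq x y : quat (dual T) :=
  Quat (Dual (qre x) (qre y)) (Dual (qi x) (qi y))
       (Dual (qj x) (qj y)) (Dual (qk x) (qk y)).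

Definition stdq (z : quat (dual T)) : quat T :=
  Quat (dre (qre z)) (dre (qi z)) (dre (qj z)) (dre (qk z)).

Definition infq (z : quat (dual T)) : quat T :=
  Quat (dinf (qre z)) (dinf (qi z)) (dinf (qj z)) (dinf (qk z)).

Lemma stdqK x y : stdq (dualq x y) = x. Proof. by case: x. Qed.

Lemma infqK x y : infq (dualq x y) = y. Proof. by case: y. Qed.

Lemma dualqK (z : quat (dual T)) : dualq (stdq z) (infq z) = z.
Proof. by case: z => [[??] [??] [??] [??]]. Qed.

Lemma dualqM x y x' y' :
  dualq x y * dualq x' y' = dualq (x * x') (x * y' + y * x').
Proof.
case: x => ????; case: y => ????; case: x' => ????; case: y' => ????.
rewrite /dualq !quatM quatD !dualM !dualN !dualD /=.
by congr Quat; congr Dual; ring.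
Qed.

Lemma dualq_sum I (r : seq I) (F G : I -> quat T) :
  dualq (\sum_(i <- r) F i) (\sum_(i <- r) G i) =
  \sum_(i <- r) dualq (F i) (G i).
Proof. by elim/big_rec3: _ => //= i y1 y2 y3 _ <-. Qed.

Lemma conjq_dualq x y : conjq (dualq x y) = dualq (conjq x) (conjq y).
Proof. by []. Qed.

Definition dualqmx m n (A : dualmx (quat T) m n) : 'M[quat (dual T)]_(m, n) :=
  \matrix_(i, j) dualq (stdpart A i j) (infpart A i j).

Definition dualmxq m n (A : 'M[quat (dual T)]_(m, n)) : dualmx (quat T) m n :=
  DualMx (map_mx stdq A) (map_mx infq A).

Lemma dualmxqK m n (A : 'M[quat (dual T)]_(m, n)) : dualqmx (dualmxq A) = A.
Proof. by apply/matrixP => i j; rewrite !mxE dualqK. Qed.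

Lemma dualqmxK m n (A : dualmx (quat T) m n) : dualmxq (dualqmx A) = A.
Proof.
by case: A => A B; congr DualMx; apply/matrixP => i j;
  rewrite !mxE ?stdqK ?infqK.
Qed.

Lemma dualqmxM m n p (A : dualmx (quat T) m n) (B : dualmx (quat T) n p) :
  dualqmx (dualmx_mul A B) = dualqmx A *m dualqmx B.
Proof.
apply/matrixP => i j; rewrite !mxE -big_split dualq_sum.
by apply: eq_bigr => k _; rewrite !mxE dualqM.
Qed.

Lemma dualqmx_scalar n x y :
  dualqmx (DualMx x%:M y%:M) = (dualq x y)%:M :> 'M_n.
Proof.
by apply/matrixP => i j; rewrite !mxE; case: eqP.
Qed.

Lemma dualqmx1 n : dualqmx (dualmx1 (quat T) n) = 1%:M.
Proof. by rewrite -[RHS](dualqmx_scalar n 1 0) raddf0. Qed.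

Lemma dualqmx_herm m n (A : dualmx (quat T) m n) :
  dualqmx (dualmx_herm A) = hermq (dualqmx A).
Proof. by apply/matrixP => i j; rewrite !mxE. Qed.

Lemma dualqmx_etaherm x m n (A : dualmx (quat T) m n) :
  dualqmx (dualmx_etaherm x A) = etahermq (dualq x 0) (dualqmx A).
Proof.
rewrite /etahermq conjq_dualq conjq0 -dualqmx_herm -!dualqmx_scalar.
rewrite -!dualqmxM; congr dualqmx.
by rewrite /dualmx_mul /= !raddf0 !mul0mx !addr0 add0r.
Qed.

End DualQuaternion.

(* First-order perturbation: [lambda] is an eigenvalue of [M] and [x] is an
   eigenvector of the compression of [N] to the eigenspace of [lambda], along
   the image of [M - lambda]. *)
Lemma dual_eigenvector (F : numClosedFieldType) n (M N : 'M[F]_n) :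
  (0 < n)%N ->
  (forall a (x y : 'rV_n),
    x *m M = a *: x -> x = y *m M - a *: y -> x = 0) ->
  exists (x y : 'rV_n) (a m : F),
    [/\ x != 0, x *m M = a *: x & x *m N + y *m M = a *: y + m *: x].
Proof.
move=> n_gt0 kerim; have [a Ma] := eigenvalue_closed M n_gt0.
pose E := eigenspace M a; pose T := M - a%:M.
have ET0 : (E :&: T = 0)%MS.
  apply/eqP; rewrite -submx0; apply/rV_subP => x.
  rewrite sub_capmx => /andP[/eigenspaceP xM /submxP[y xy]].
  by rewrite (kerim a x y) ?sub0mx // xy mulmxBr mul_mx_scalar.
(* Rank-nullity: [E] is the left kernel of [T], so the direct sum has full rank. *)
have ET1 (u : 'rV_n) : (u <= E + T)%MS.
  apply: submx_full; rewrite /row_full mxrank_disjoint_sum // mxrank_ker.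
  by rewrite subnK ?rank_leq_row.
have [P PE PT] : exists2 P : 'M_n, forall k (W : 'M_(k, n)), (W *m P <= E)%MS &
    forall u : 'rV_n, (u - u *m P <= T)%MS.
  exists (proj_mx E T) => [k W|u]; first exact: proj_mx_sub.
  exact: proj_mx_compl_sub.
pose B := row_base E.
(* The compression of [N] written in the basis [B] of [E], a square matrix of positive size, which
   therefore has an eigenvalue. *)
pose C := B *m N *m P *m pinvmx B.
have rE : (0 < \rank E)%N by rewrite lt0n mxrank_eq0.
have [m /eigenvalueP[z zC z0]] := eigenvalue_closed C rE.
pose x := z *m B.
have xP : x *m N *m P = m *: x.
  rewrite /x scalemxAl -zC -[z *m C *m B]mulmxA /C mulmxKpV ?mulmxA //.
  by rewrite eq_row_base PE.
(* What the projection removes from [x N] is the image of some [y] under [M - a]; the first-order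
   term is [- y]. *)
have /submxP[y yT] := PT (x *m N).
exists x, (- y), a, m; split.
- by rewrite mulmx_free_eq0 ?row_base_free.
- by apply/eigenspaceP; rewrite mulmx_sub // eq_row_base.
have xN : x *m N = y *m M - a *: y + m *: x.
  by rewrite -mul_mx_scalar -mulmxBr -yT xP subrK.
by rewrite xN mulNmx scalerN addrAC [_ - a *: y]addrC addrK.
Qed.

(** * Positivity and square roots in the dual numbers *)

Section DualPositive.

Variable R : rcfType.
Implicit Types t : dual R.

Lemma dual_sqrt_inv t : 0 < dre t -> exists r, r * r * t = 1.
Proof.
move=> t_gt0; pose s := Num.sqrt (dre t).
have s0 : s != 0 by rewrite gt_eqF // sqrtr_gt0.
have st : dre t = s ^+ 2 by rewrite sqr_sqrtr // ltW.
(* The first-order expansion of the inverse square root at [dre t]. *)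
exists (Dual s^-1 (- dinf t / (2 * s ^+ 3))).
rewrite !dualM /= st dual1; congr Dual; field; rewrite ?s0 ?pnatr_eq0 //.
Qed.

(** A dual number with zero standard part squares to zero. Being zero or having positive standard
    part is also stable under sums, so every squared norm is either zero or invertible. *)
Lemma sqr_dual_cone (x : dual R) : x ^+ 2 = 0 \/ 0 < dre (x ^+ 2).
Proof.
rewrite expr2 dualM /= -expr2 exprn_even_gt0 //=.
case: (eqVneq (dre x) 0) => [->|]; last by right.
by left; rewrite dual0; congr Dual; ring.
Qed.

Lemma add_dual_cone s t :
  s = 0 \/ 0 < dre s -> t = 0 \/ 0 < dre t -> s + t = 0 \/ 0 < dre (s + t).
Proof.
move=> [->|s0] [->|t0]; rewrite ?addr0 ?add0r; [by left|by right..|].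
by right; rewrite /= addr_gt0.
Qed.

Lemma normsq_dual_cone n (u : 'rV[quat (dual R)]_n)
    (t := \sum_i normsq (u 0 i)) : t = 0 \/ 0 < dre t.
Proof.
rewrite /t; elim/big_ind: _ => [|x y|i _]; [by left|exact: add_dual_cone|].
by rewrite /normsq; do 3![apply: add_dual_cone; last exact: sqr_dual_cone];
  exact: sqr_dual_cone.
Qed.

End DualPositive.

(** * Quaternionic rows as complex rows *)

Section Complexification.

Variable R : rcfType.
Local Notation C := R[i].

(* A quaternionic row [a + b j] is the complex row [(a, b)]. *)
Definition qrow n (x : 'rV[C]_(n + n)) : 'rV[quat R]_n :=
  \row_j Quat (complex.Re (x 0 (lshift n j))) (complex.Im (x 0 (lshift n j)))
              (complex.Re (x 0 (rshift n j))) (complex.Im (x 0 (rshift n j))).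

Definition crow n (u : 'rV[quat R]_n) : 'rV[C]_(n + n) :=
  row_mx (\row_j Complex (qre (u 0 j)) (qi (u 0 j)))
         (\row_j Complex (qj (u 0 j)) (qk (u 0 j))).

Definition embc (z : C) : quat R := Quat (complex.Re z) (complex.Im z) 0 0.

Lemma crowK n : cancel (@crow n) (@qrow n).
Proof.
move=> u; apply/rowP => j; rewrite !mxE.
rewrite (unsplitK (inl j)) (unsplitK (inr j)) !mxE /=.
by case: (u 0 j).
Qed.

Lemma qrowK n : cancel (@qrow n) (@crow n).
Proof.
move=> x; rewrite -[RHS]hsubmxK; congr row_mx; apply/rowP => j;
  by rewrite !mxE /=; case: (x 0 _).
Qed.

Lemma qrowD n (x y : 'rV[C]_(n + n)) : qrow (x + y) = qrow x + qrow y.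
Proof.
apply/rowP => j; rewrite !mxE quatD /=.
by case: (x 0 (lshift n j)); case: (x 0 (rshift n j));
  case: (y 0 (lshift n j)); case: (y 0 (rshift n j)).
Qed.

Lemma qrowZ n a (x : 'rV[C]_(n + n)) :
  qrow (a *: x) = (embc a)%:M *m qrow x.
Proof.
apply/rowP => j; rewrite mul_scalar_mx !mxE /embc quatM.
case: (x 0 (lshift n j)) => b c; case: (x 0 (rshift n j)) => d e.
by case: a => a a' /=; congr Quat; ring.
Qed.

Section ComplexMatrix.

Variables (n : nat) (K : 'M[quat R]_n).

Definition crow_mul (x : 'rV[C]_(n + n)) := crow (qrow x *m K).

(** Complex scalars multiply rows on the left and [K] on the right, so the two actions commute by
    associativity. *)
Lemma crow_mul_is_linear : linear crow_mul.
Proof.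
move=> a x y; apply: (can_inj (@qrowK n)).
by rewrite qrowD qrowZ !crowK qrowD qrowZ mulmxDl mulmxA.
Qed.

HB.instance Definition _ :=
  GRing.isLinear.Build C 'rV[C]_(n + n) 'rV[C]_(n + n) _ crow_mul
    crow_mul_is_linear.

Definition complex_mx := lin1_mx crow_mul.

Lemma qrow_complex_mx x : qrow (x *m complex_mx) = qrow x *m K.
Proof. by rewrite mul_rV_lin1 crowK. Qed.

End ComplexMatrix.

Lemma sum_normsq_eq0 n (u : 'rV[quat R]_n) :
  \sum_i normsq (u 0 i) = 0 -> u = 0.
Proof.
have n0 (x : quat R) : 0 <= normsq x by rewrite /normsq !addr_ge0 ?sqr_ge0.
move=> /eqP; rewrite psumr_eq0 // => /allP u0; apply/rowP => i; rewrite mxE.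
have := u0 i (mem_index_enum _); rewrite /normsq.
case: (u 0 i) => a b c d /=.
rewrite !paddr_eq0 ?addr_ge0 ?sqr_ge0 // !sqrf_eq0.
by move=> /andP[/andP[/andP[/eqP-> /eqP->] /eqP->] /eqP->].
Qed.

Lemma qre_mulC (x y : quat R) : qre (x * y) = qre (y * x).
Proof. by case: x => ????; case: y => ????; rewrite !quatM /=; ring. Qed.

(* As [l] is purely imaginary, [x x^H = z l - l z] with [z = y x^H], and the
   real part of a commutator vanishes. *)
Lemma skew_ker_im n (K : 'M[quat R]_n) (l : quat R) (x y : 'rV_n) :
  hermq K = - K -> qj l = 0 -> qk l = 0 ->
  x *m K = l%:M *m x -> x = y *m K - l%:M *m y -> x = 0.
Proof.
move=> KN lj lk xK xy; set t := \sum_i normsq (x 0 i).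
have xx : x *m hermq x = (realq t)%:M := hermq_row_normsq x.
have [/sum_normsq_eq0//|t0] := eqVneq t 0.
have lN : conjq l = - l.
  have: hermq (x *m K *m hermq x) = - (x *m K *m hermq x).
    by rewrite !hermqM hermqK KN mulNmx mulmxN mulmxA.
  rewrite xK -mulmxA xx -scalar_mxM hermq_scalar => /matrixP/(_ 0 0).
  rewrite !mxE eqxx !mulr1n; case: l lj lk {xK xy} => a b c d /= -> ->.
  rewrite /realq quatM !mulr0 !mul0r !subr0 /conjq quatN /= => -[at0].
  suff -> : a = 0 by rewrite oppr0.
  by apply: (mulIf t0); rewrite mul0r; lra.
(* The adjoint of the eigenrow equation: both [K] and [l] change sign under conjugation. *)
have Kx : K *m hermq x = hermq x *m l%:M.
  apply: (can_inj (@hermqK _ _ _)).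
  by rewrite !hermqM hermqK hermq_scalar KN mulmxN xK lN scalar_mxN mulNmx.
have : x *m hermq x = y *m hermq x *m l%:M - l%:M *m (y *m hermq x).
  by rewrite {1}xy mulmxBl -!mulmxA Kx.
rewrite xx [y *m _]mx11_scalar -!scalar_mxM => /matrixP/(_ 0 0).
rewrite !mxE eqxx !mulr1n => /(congr1 (@qre R)) /= t_eq0.
by case/eqP: t0; rewrite t_eq0 /= qre_mulC subrr.
Qed.

End Complexification.

(** * The spectral theorem over the dual quaternions *)

Section DualSpectral.

Variable R : rcfType.
Local Notation D := (dual R).

Lemma dual_half : Dual (2^-1) 0 + Dual (2^-1) 0 = 1 :> D.
Proof. by rewrite dual1 dualD /=; congr Dual; [field|rewrite addr0]. Qed.

Lemma dre_normsq (x : quat D) : dre (normsq x) = normsq (stdq x).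
Proof. by []. Qed.

(** The zeroth- and first-order equations given by [dual_eigenvector] are the two parts of a single
    equation [u K = l u], with [l] having no j or k component. *)
Lemma dual_quat_eigenrow n (K : 'M[quat D]_n.+1) : hermq K = - K ->
  exists (u : 'rV_n.+1) (s : D), u *m hermq u = 1%:M /\
    u *m K = (Quat 0 s 0 0)%:M *m u.
Proof.
set Ks := stdpart (dualmxq K); set Ki := infpart (dualmxq K).
have KE : K = dualqmx (DualMx Ks Ki) by rewrite [RHS]dualmxqK.
move=> KN; have KsN : hermq Ks = - Ks.
  apply/matrixP => i j; have /matrixP/(_ i j) := KN.
  by rewrite !mxE => /(congr1 (@stdq R)).
clearbody Ks Ki.
have q0 : qrow (0 : 'rV[R[i]]_(n.+1 + n.+1)) = 0.
  by rewrite -(scale0r 0) qrowZ [embc 0]/(0 : quat R) raddf0 mul0mx.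
have kerim a (x y : 'rV[R[i]]_(n.+1 + n.+1)) :
    x *m complex_mx Ks = a *: x -> x = y *m complex_mx Ks - a *: y -> x = 0.
  move=> xK xy; apply: (can_inj (@qrowK _ _)).
  rewrite q0; apply: (@skew_ker_im _ _ Ks (embc a) _ (qrow y)) => //.
    by rewrite -qrow_complex_mx xK qrowZ.
  rewrite {1}xy qrowD qrow_complex_mx -scaleNr qrowZ.
  congr (_ + _); rewrite -mulNmx; congr (_ *m _).
  by rewrite -scalar_mxN; congr (_%:M); case: (a) => b c;
    rewrite quatN /= oppr0.
have [//|x [y [a [m [x0 xK yK]]]]] :=
  dual_eigenvector (complex_mx Ki) _ kerim.
pose u := dualqmx (DualMx (qrow x) (qrow y)).
pose l := dualq (embc a) (embc m).
have uK : u *m K = l%:M *m u.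
  rewrite KE /u /l -dualqmx_scalar -!dualqmxM; congr dualqmx.
  rewrite /dualmx_mul /= -!qrow_complex_mx xK qrowZ; congr DualMx.
  by rewrite -qrowD yK qrowD !qrowZ.
have ut := hermq_row_normsq u.
(* The standard part of this sum is the squared norm of [qrow x], nonzero with [x]; the dichotomy
   then makes it positive, so [u] can be normalized. *)
have t0 : \sum_i normsq (u 0 i) <> 0.
  move=> /(congr1 (@dre R)); rewrite dre_sum => t0.
  case/eqP: x0; apply: (can_inj (@qrowK _ _)); rewrite q0.
  apply: sum_normsq_eq0; rewrite -[RHS]t0; apply: eq_bigr => i _.
  by rewrite dre_normsq !mxE stdqK.
have [//|/dual_sqrt_inv[r rt]] := normsq_dual_cone u.
exact: (normalized_eigenrow dual_half KN ut rt _ _ uK).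
Qed.

Lemma dual_quat_spectral n (K : 'M[quat D]_n) : hermq K = - K ->
  exists (V : 'M_n) (d : 'rV[D]_n), V *m hermq V = 1%:M /\
    K = V *m (map_mx (@realq D) (diag_mx d) *m (Quat 0 1 0 0)%:M) *m hermq V.
Proof.
move: n K; apply: skew_hermitian_spectral; first exact: dual_quat_eigenrow.
move=> n a b ab1; have bt := hermq_row_normsq b.
apply: (unitary_row dual_half _ ab1 bt).
have [t0|/dual_sqrt_inv[r rt]] := normsq_dual_cone b; first by left.
by right; exists (r * r).
Qed.

(** Unless [eta] is -i, take [p] to be i + [eta] normalized: multiplying it by [eta] on the right or
    by i on the left gives i [eta] - 1 in both cases, and its squared norm is 2 + 2b. For [eta] =
    -i, take j. *)
Lemma rotate_to_i (eta : quat R) : unit_pure_imaginary eta ->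
  exists p, conjq p * p = 1 /\ p * eta = Quat 0 1 0 0 * p.
Proof.
case: eta => e b c d [/= ->]; rewrite /normsq /= expr0n /= add0r => n1.
have [b1|b1] := eqVneq b (- 1).
  have c0 : c = 0 by apply/eqP; rewrite -sqrf_eq0; apply/eqP; nra.
  have d0 : d = 0 by apply/eqP; rewrite -sqrf_eq0; apply/eqP; nra.
  exists (Quat 0 0 1 0); rewrite b1 c0 d0 /conjq !quatM quat1 /=.
  split; congr Quat; ring.
have b2 : 0 < 2 + 2 * b.
  rewrite lt_neqAle; apply/andP; split; last by nra.
  by apply: contra b1 => /eqP b2; apply/eqP; lra.
pose r := (Num.sqrt (2 + 2 * b))^-1.
have r2 : r * r * (2 + 2 * b) = 1.
  rewrite -invfM -expr2 sqr_sqrtr ?ltW // mulVf // gt_eqF //.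
exists (Quat 0 (r * (b + 1)) (r * c) (r * d)).
rewrite /conjq !quatM quat1 /=; split; congr Quat; try ring.
  transitivity (r * r * (b ^+ 2 + c ^+ 2 + d ^+ 2 + 2 * b + 1)); first by ring.
  by rewrite n1 -[RHS]r2; ring.
transitivity (- (r * (b ^+ 2 + c ^+ 2 + d ^+ 2 + b))); first by ring.
by rewrite n1; ring.
Qed.

End DualSpectral.

Theorem theorem3p3 (R : realType) (n : nat) (eta : quat R)
    (A : dualmx (quat R) n n) :
  unit_pure_imaginary eta ->
  eta_hermitian eta A ->
  exists (V : dualmx (quat R) n n) (Sigma : dualmx R n n),
    [/\ dualmx_unitary V,
        dualmx_diag Sigma &
        A = dualmx_mul (dualmx_mul V (dualmx_realq Sigma))
                       (dualmx_etaherm eta V)].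
Proof.
move=> eta_unit AH; have [p [pp peta]] := rotate_to_i eta_unit.
(* The relations on [eta] and [p] persist over the dual numbers when both get zero infinitesimal
   part. *)
pose lift (x : quat R) := dualq x 0.
have liftM x y : lift x * lift y = lift (x * y).
  by rewrite /lift dualqM mulr0 mul0r addr0.
have etaN : conjq (lift eta) = - lift eta.
  by rewrite /lift conjq_dualq conjq0 (unit_pure_imaginary_conj eta_unit)
    quatN [RHS]quatN /= !dualN /= oppr0.
have eta2 : lift eta * lift eta = -1.
  rewrite liftM -expr2 (unit_pure_imaginary_sqr eta_unit).
  by rewrite /lift /dualq !quat1 !quatN /= !dual1 !dual0 !dualN /= !oppr0.
have lift_pp : conjq (lift p) * lift p = 1.
  by rewrite /lift conjq_dualq conjq0 liftM pp.
have lift_peta : lift p * lift eta = Quat 0 1 0 0 * lift p.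
  by rewrite liftM peta -liftM.
have [|V [d [VV AE]]] := eta_hermitian_of_skew etaN eta2 lift_pp lift_peta
  (@dual_quat_spectral R n) (A := dualqmx A).
  by rewrite -dualqmx_etaherm; congr dualqmx.
(* The diagonal entries are dual numbers; their two coefficients form the two real diagonal
   matrices. *)
exists (dualmxq V), (DualMx (map_mx (@dre R) (diag_mx d))
                            (map_mx (@dinf R) (diag_mx d))).
split.
- apply: (can_inj (@dualqmxK _ _ _)).
  by rewrite dualqmxM dualqmx_herm dualmxqK dualqmx1.
- by split; apply/is_diag_mxP => i j ij; rewrite !mxE -val_eqE /= (negPf ij).
apply: (can_inj (@dualqmxK _ _ _)).
rewrite !dualqmxM dualqmx_etaherm dualmxqK AE; congr (_ *m _ *m _).
by apply/matrixP => i j; rewrite !mxE; case: (_ *+ _).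
Qed.
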